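(* For all integers $r\ge 2$ and $s\ge r+1$, there are no Cremona-reduced numerical $(-1)$-Weyl classes $c=(d;m_1,\dots,m_s)\in A^{r-1}(Y^r_s)$ with $d$ and all $m_i$ non-negative which are $(-1)$-Weyl line classes, i.e. which are Cremona-equivalent to $h-e_1-e_2$.
   Context: $Y^r_s$ is the blowup of $\mathbb{P}^r$ at $s$ general points. Its group of curve classes $A^{r-1}(Y^r_s)$ is the free abelian group with basis $h$ (class of a general line) and $e_1,\dots,e_s$ ($e_i$ the class of a line in the $i$-th exceptional divisor). A class $c=dh-\sum_i m_ie_i$ is also written $(d;m_1,\dots,m_s)$; $d$ is its degree and the $m_i$ are its multiplicities. For $I\subset\{1,\dots,s\}$ with $|I|=r+1$, the standard Cremona transformation $\phi_I$ acts on $A^{r-1}(Y^r_s)$ by $dh-\sum m_ie_i\mapsto d'h-\sum m_i'e_i$, where with $t=d-\sum_{i\in I}m_i$ one has $d'=d+(r-1)t$, $m_i'=m_i+t$ for $i\in I$, $m_i'=m_i$ for $i\notin I$. The Weyl group is generated by all $\phi_I$ and the permutations of $e_1,\dots,e_s$. Two classes are Cremona-equivalent if they are in the same orbit of the Weyl group. A class is Cremona reduced if $d\ge\sum_{i\in I}m_i$ for every $(r+1)$-subset $I$ of the indices. The bilinear form on $A^{r-1}$ is given by $\langle h,h\rangle=1$, $\langle h,e_i\rangle=0$, $\langle e_i,e_j\rangle=(1-r)\delta_{ij}$, and $F=(r+1)h-\sum_{i=1}^se_i$. A numerical $(-1)$-Weyl class is a class $c$ with $\langle c,F\rangle=3-r$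 and $\langle c,c\rangle=3-2r$. *)

(* Defs.v *)
From HB Require Import structures.
From mathcomp Require Import all_boot all_order all_algebra all_fingroup.

Set Implicit Arguments.
Unset Strict Implicit.
Unset Printing Implicit Defensive.

Import Order.TTheory GRing.Theory Num.Theory.
Local Open Scope ring_scope.

(* The free abelian group A^{r-1}(Y^r_s) on h, e_1, ..., e_s: an element is its
   pair of coordinates (coefficient of h, coefficients of the e_i).
   Indices are shifted by one: e_{k+1} is ecls i with i = k :> nat. *)
Definition curve_class (s : nat) : zmodType := (int * {ffun 'I_s -> int})%type.

Definition hcls (s : nat) : curve_class s := (1, 0).

Definition ecls (s : nat) (i : 'I_s) : curve_class s :=
  (0, [ffun j => (j == i)%:Z]).

(* The class (d; m_1, ..., m_s) = d h - \sum_i m_i e_i. *)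
Definition mkclass (s : nat) (d : int) (m : 'I_s -> int) : curve_class s :=
  hcls s *~ d - \sum_(i < s) ecls i *~ m i.

Definition deg (s : nat) (c : curve_class s) : int := c.1.

(* Sign: m_i is minus the coefficient of e_i. *)
Definition mult (s : nat) (c : curve_class s) (i : 'I_s) : int := - c.2 i.

Lemma deg_mkclass (s : nat) (d : int) (m : 'I_s -> int) :
  deg (mkclass d m) = d.
Proof.
rewrite /deg /mkclass /= raddfMz intz raddf_sum big1 ?subr0 // => i _.
by rewrite raddfMz /= mul0rz.
Qed.

Lemma mult_mkclass (s : nat) (d : int) (m : 'I_s -> int) (i : 'I_s) :
  mult (mkclass d m) i = m i.
Proof.
rewrite /mult /mkclass /= raddfMz /= mul0rz sub0r raddf_sum !ffunE.
rewrite sum_ffunE (bigD1 i) //= big1 => [|j ji].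
  by rewrite addr0 raddfMz /= ffunMzE ffunE eqxx intz opprK.
by rewrite raddfMz /= ffunMzE ffunE eq_sym (negPf ji) mul0rz.
Qed.

Lemma mkclassK (s : nat) (c : curve_class s) : mkclass (deg c) (mult c) = c.
Proof.
have hd := deg_mkclass (deg c) (mult c).
have hm := mult_mkclass (deg c) (mult c).
apply/eqP; rewrite -pair_eqE /pair_eq /=; apply/andP; split; first exact/eqP.
by apply/eqP/ffunP => i; apply: oppr_inj; apply: hm.
Qed.

(* <h, h> = 1, <h, e_i> = 0, <e_i, e_j> = (1 - r) delta_ij. *)
Definition form (r s : nat) (x y : curve_class s) : int :=
  x.1 * y.1 + (1 - r%:Z) * \sum_(i < s) x.2 i * y.2 i.

Definition Fcls (r s : nat) : curve_class s :=
  hcls s *+ r.+1 - \sum_(i < s) ecls i.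

Definition cremona (r s : nat) (I : {set 'I_s}) (c : curve_class s) :
    curve_class s :=
  let t := deg c - \sum_(i in I) mult c i in
  mkclass (deg c + (r%:Z - 1) * t)
          (fun i => if i \in I then mult c i + t else mult c i).

(* The automorphism fixing h and sending e_i to e_{sigma i}. *)
Definition perm_class (s : nat) (sigma : {perm 'I_s}) (c : curve_class s) :
    curve_class s :=
  hcls s *~ deg c - \sum_(i < s) ecls (sigma i) *~ mult c i.

(* Membership in the group of bijections of curve_class s generated by the
   standard Cremona transformations and the permutations of the e_i. *)
Inductive weyl_group (r s : nat) : (curve_class s -> curve_class s) -> Prop :=
| weyl_cremona (I : {set 'I_s}) : #|I| = r.+1 -> weyl_group r (cremona r I)
| weyl_perm (sigma : {perm 'I_s}) : weyl_group r (perm_class sigma)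
| weyl_id : weyl_group r id
| weyl_comp f g : weyl_group r f -> weyl_group r g -> weyl_group r (f \o g)
| weyl_inv f g :
    weyl_group r f -> cancel f g -> cancel g f -> weyl_group r g.

Definition cremona_equivalent (r s : nat) (x y : curve_class s) : Prop :=
  exists2 w, weyl_group r w & w x = y.

Definition cremona_reduced (r s : nat) (c : curve_class s) : Prop :=
  forall I : {set 'I_s}, #|I| = r.+1 -> \sum_(i in I) mult c i <= deg c.

Definition numerical_weyl (r s : nat) (c : curve_class s) : Prop :=
  form r c (Fcls r s) = 3 - r%:Z /\ form r c c = 3 - 2 * r%:Z.

Definition weyl_line (r s : nat) (c : curve_class s) : Prop :=
  exists i j : 'I_s, [/\ i = 0%N :> nat, j = 1%N :> nat &
    cremona_equivalent r c (hcls s - ecls i - ecls j)].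

(* Main.v *)
Require Import Defs.
From mathcomp Require Import all_boot all_order all_algebra all_fingroup.
From mathcomp Require Import ring zify.

(** A Cremona reduced class has the least degree in its Weyl orbit
    ([reduced_deg_le]).  As [h - e_1 - e_2] has degree 1, a reduced line class
    [c] with non-negative degree has degree 0 or 1.  Degree 0 contradicts the
    two numerical conditions: they read [(r-1) * \sum m_i = r - 3] and
    [(r-1) * \sum m_i^2 = 2r - 3], so [r - 1] divides 1, hence [r = 2] and
    [\sum m_i = -1].  In degree 1 the linear condition gives [\sum m_i = 2],
    but being reduced forces [\sum m_i <= 1] ([reduced_line_sum_mult]): the
    [r+1] largest multiplicities already add up to at most 1, so one of them
    is 0 and so are all the smaller ones.

    Minimality of the degree is the usual fact that a dominant vector is the
    lowest one of its orbit under a simply laced Coxeter group.  A direct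
    combinatorial argument avoids the theory of root systems.  The Weyl group is
    generated by the simple reflections [x |-> x + a_i(x) b_i]: one Cremona
    transformation, on the first [r+1] indices, and the transpositions of
    adjacent indices.
    Call such a reflection a move when [a_i(x) < 0]; a move never raises the
    degree.  By the commutation and braid relations the moves satisfy a diamond
    property, as in Mozes's numbers game: if some sequence of moves leads from
    [x] to a dominant [c], then every move out of [x] can be continued to [c],
    in the same total number of moves ([descends_move]).  Hence the set of all
    vectors that descend to [c] is stable under every simple reflection, so it
    contains the whole orbit of [c].  A reduced class becomes dominant once its
    multiplicities are sorted. *)

Set Implicit Arguments.
Unset Strict Implicit.
Unset Printing Implicit Defensive.

Import Order.TTheory GRing.Theory Num.Theory.

Local Open Scope ring_scope.

(** * Descent to a dominant vector under simply laced reflections *)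

Section NumbersGame.

Variables (V : zmodType) (I : eqType) (a : I -> V -> int) (b : I -> V).

Definition reflect_by (i : I) (x : V) : V := x + b i *~ a i x.

(** The length [n] is recorded because [descends_move] is an induction on it:
    its braid case needs the induction hypothesis for a descent that is not a
    tail of the given one, but is shorter. *)
Fixpoint descends (c : V) (n : nat) (x : V) : Prop :=
  if n is n'.+1 then exists2 i, a i x < 0 & descends c n' (reflect_by i x)
  else x = c.

Hypothesis a_linear : forall i x y k, a i (x + y *~ k) = a i x + a i y * k.
Hypothesis a_diag : forall i, a i (b i) = - 2.
Hypothesis a_offdiag : forall i j, i != j ->
  (a i (b j) = 0 /\ a j (b i) = 0) \/ (a i (b j) = 1 /\ a j (b i) = 1).

Lemma pairing_reflect i j x :
  a i (reflect_by j x) = a i x + a i (b j) * a j x.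
Proof. exact: a_linear. Qed.

Lemma pairing_reflect_same i x : a i (reflect_by i x) = - a i x.
Proof. rewrite pairing_reflect a_diag; lia. Qed.

Lemma reflect_byK i : involutive (reflect_by i).
Proof.
move=> x; rewrite {1}/reflect_by pairing_reflect_same /reflect_by mulrNz.
by rewrite addrK.
Qed.

Lemma reflect_by_comm i j x : a i (b j) = 0 -> a j (b i) = 0 ->
  reflect_by i (reflect_by j x) = reflect_by j (reflect_by i x).
Proof.
move=> ij ji; rewrite {1}/reflect_by {3}/reflect_by !pairing_reflect ij ji.
by rewrite !mul0r !addr0 /reflect_by addrAC.
Qed.

Lemma reflect_by_braid i j x : a i (b j) = 1 -> a j (b i) = 1 ->
  reflect_by i (reflect_by j (reflect_by i x)) =
  reflect_by j (reflect_by i (reflect_by j x)).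
Proof.
suff step k l : a k (b l) = 1 -> a l (b k) = 1 ->
    reflect_by k (reflect_by l (reflect_by k x)) =
    x + (b k + b l) *~ (a k x + a l x).
  by move=> ij ji; rewrite !step // [b j + b i]addrC [a j x + a i x]addrC.
move=> kl lk.
have El : a l (reflect_by k x) = a k x + a l x.
  by rewrite pairing_reflect lk mul1r addrC.
have Ek : a k (reflect_by l (reflect_by k x)) = a l x.
  by rewrite !pairing_reflect a_diag lk kl !mul1r; lia.
rewrite {1}/reflect_by Ek {1}/reflect_by El /reflect_by -!addrA; congr (_ + _).
by rewrite mulrzDl addrCA -mulrzDr addrC.
Qed.

(** Strong convergence, by induction on the length.  If the given descent
    starts with another move [j], the move [i] is still available after [j];
    following the commutation or braid relation from there closes a square or
    a hexagon, whose other side starts with [i] and has the same length. *)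
Lemma descends_move c : (forall i, 0 <= a i c) ->
  forall n x i, descends c n x -> a i x < 0 ->
  exists2 m, n = m.+1 & descends c m (reflect_by i x).
Proof.
move=> dom_c; elim/ltn_ind=> -[|n] IH x i /=.
  by move=> -> lt0; have := dom_c i; rewrite leNgt lt0.
case=> j jx dj ix; have [<-|ij] := eqVneq j i; first by exists n.
exists n => //; case: (a_offdiag ij) => -[aji aij].
- have iy : a i (reflect_by j x) < 0 by rewrite pairing_reflect aij mul0r addr0.
  have [m Em dm] := IH n (ltnSn n) _ _ dj iy.
  rewrite Em; exists j; last by rewrite reflect_by_comm.
  by rewrite pairing_reflect aji mul0r addr0.
- have iy : a i (reflect_by j x) < 0.
    by rewrite pairing_reflect aij mul1r; lia.
  have [m Em dm] := IH n (ltnSn n) _ _ dj iy.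
  have jz : a j (reflect_by i (reflect_by j x)) < 0.
    by rewrite !pairing_reflect a_diag aij aji !mul1r; lia.
  have [p Ep dp] := IH m ltac:(lia) _ _ dm jz.
  rewrite Em Ep; exists j; first by rewrite pairing_reflect aji mul1r; lia.
  exists i; last by rewrite reflect_by_braid.
  by rewrite !pairing_reflect a_diag aij aji !mul1r; lia.
Qed.

(** A reflection is a move, the reverse of a move, or the identity at [x],
    according to the sign of [a i x]; only the first case needs the diamond
    property. *)
Lemma descends_reflect c : (forall i, 0 <= a i c) ->
  forall i x, (exists n, descends c n x) ->
  exists n, descends c n (reflect_by i x).
Proof.
move=> dom_c i x [n dx]; case: (ltrgt0P (a i x)) => ix.
- by exists n.+1, i; rewrite ?reflect_byK // pairing_reflect_same; lia.
- by have [m _ dm] := descends_move dom_c dx ix; exists m.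
- by exists n; rewrite /reflect_by ix mulr0z addr0.
Qed.

Lemma descends_le (f : V -> int) c :
  (forall x y k, f (x + y *~ k) = f x + f y * k) ->
  (forall i, 0 <= f (b i)) ->
  forall n x, descends c n x -> f c <= f x.
Proof.
move=> f_linear f_b; elim=> [|n IH] x /=; first by move->.
case=> i ix /IH /le_trans; apply.
by rewrite f_linear; have := f_b i; nia.
Qed.

End NumbersGame.

(** * Degrees, multiplicities and the generators of the Weyl group *)

Lemma deg_linear s (x y : curve_class s) k :
  deg (x + y *~ k) = deg x + deg y * k.
Proof. by rewrite /deg /= raddfMz /= -mulrzr intz. Qed.

Lemma mult_linear s (x y : curve_class s) k i :
  mult (x + y *~ k) i = mult x i + mult y i * k.
Proof.
by rewrite /mult /= raddfMz /= !ffunE ffunMzE opprD -mulrzr intz mulNr.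
Qed.

Lemma curve_class_eq s (x y : curve_class s) :
  deg x = deg y -> mult x =1 mult y -> x = y.
Proof.
case: x y => [d m] [d' m']; rewrite /deg /mult /= => -> E; congr pair.
by apply/ffunP=> i; apply: oppr_inj; apply: E.
Qed.

Lemma deg_perm_class s (sigma : {perm 'I_s}) c :
  deg (perm_class sigma c) = deg c.
Proof.
rewrite /perm_class (reindex_perm (sigma^-1)%g) /=.
under eq_bigr do rewrite permKV.
exact: deg_mkclass.
Qed.

Lemma mult_perm_class s (sigma : {perm 'I_s}) c i :
  mult (perm_class sigma c) i = mult c ((sigma^-1)%g i).
Proof.
rewrite /perm_class (reindex_perm (sigma^-1)%g) /=.
under eq_bigr do rewrite permKV.
exact: mult_mkclass.
Qed.

Lemma perm_class1 s (c : curve_class s) : perm_class 1 c = c.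
Proof.
apply: curve_class_eq => [|i]; first exact: deg_perm_class.
by rewrite mult_perm_class invg1 perm1.
Qed.

Lemma perm_classM s (sigma tau : {perm 'I_s}) c :
  perm_class (sigma * tau) c = perm_class tau (perm_class sigma c).
Proof.
apply: curve_class_eq => [|i]; first by rewrite !deg_perm_class.
by rewrite !mult_perm_class invMg permM.
Qed.

Lemma deg_cremona r s (J : {set 'I_s}) c :
  deg (cremona r J c) =
  deg c + (r%:Z - 1) * (deg c - \sum_(i in J) mult c i).
Proof. exact: deg_mkclass. Qed.

Lemma mult_cremona r s (J : {set 'I_s}) c i :
  mult (cremona r J c) i =
  mult c i + (if i \in J then deg c - \sum_(j in J) mult c j else 0).
Proof. by rewrite mult_mkclass; case: ifP => _; rewrite ?addr0. Qed.

(** Conjugation by permutations reduces all Cremona transformations to the one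
    based on the first [r+1] indices. *)
Lemma cremona_perm_class r s (J : {set 'I_s}) (sigma : {perm 'I_s}) c :
  cremona r J (perm_class sigma c) =
  perm_class sigma (cremona r (sigma @^-1: J) c).
Proof.
have E : \sum_(i in J) mult (perm_class sigma c) i =
         \sum_(i in sigma @^-1: J) mult c i.
  rewrite (reindex_perm sigma); apply: eq_big => [i|i _]; first by rewrite inE.
  by rewrite mult_perm_class permK.
apply: curve_class_eq => [|i].
  by rewrite deg_perm_class !deg_cremona E deg_perm_class.
rewrite [RHS]mult_perm_class !mult_cremona mult_perm_class E deg_perm_class.
by rewrite inE permKV.
Qed.

(** * Sorting indices *)

Lemma exists_sorting_perm s (f : 'I_s -> int) :
  exists sigma : {perm 'I_s}, {homo f \o sigma : i j / (i <= j)%N >-> j <= i}.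
Proof.
pose t := [tuple f i | i < s].
have /tuple_permP[p Ep] : perm_eq (sort >=%R t) t by rewrite perm_sort.
exists p => i j ij /=.
have srt : sorted >=%R (sort >=%R t) by apply: sort_sorted; exact: ge_total.
have nthE (k : 'I_s) : nth 0 (sort >=%R t) k = f (p k).
  by rewrite Ep nth_mktuple tnth_mktuple.
have sizeE : size (sort >=%R t) = s by rewrite size_sort size_tuple.
rewrite -!nthE; have := sorted_leq_nth ge_trans ge_refl 0 srt.
by move=> /(_ i j); rewrite !inE sizeE; apply.
Qed.

Definition initial (s k : nat) : {set 'I_s} := [set i : 'I_s | (i < k)%N].

Lemma card_initial s k : (k <= s)%N -> #|initial s k| = k.
Proof.
move=> ks; have inj : injective (widen_ord ks).
  by move=> i j /(congr1 val) /= /val_inj.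
rewrite -[RHS]card_ord -cardsT -(card_imset _ inj); apply: eq_card => i.
rewrite inE; apply/idP/imsetP => [ik|[j _ ->]]; last exact: ltn_ord j.
by exists (Ordinal ik) => //; apply: val_inj.
Qed.

(** Sorting the indicator function of [J] moves [J] to the front. *)
Lemma exists_perm_initial s (J : {set 'I_s}) :
  exists sigma : {perm 'I_s}, sigma @^-1: J = initial s #|J|.
Proof.
have [sigma dec] := exists_sorting_perm (fun i => (i \in J)%:Z).
exists sigma; have cardJ : #|sigma @^-1: J| = #|J|.
  by apply: card_preimset; apply: perm_inj.
apply/eqP; rewrite eqEcard card_initial ?cardJ ?leqnn ?andbT; last first.
  by rewrite -[leqRHS]card_ord max_card.
apply/subsetP => i; rewrite !inE => iJ.
rewrite -cardJ -(card_initial (ltn_ord i)); apply/subset_leq_card/subsetP => j.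
rewrite !inE ltnS => /dec /=; rewrite iJ; by case: (_ \in _).
Qed.

(** * Simple roots and simple reflections *)

(** The Dynkin diagram is [T_(2, r+1, s-r-1)]: [Some (i, i+1)] is a node of the
    chain of adjacent transpositions, [None] the node of the Cremona
    transformation, attached to the [r+1]-st node of the chain if there is
    one. *)
Definition simple_root (s : nat) :=
  option {p : 'I_s * 'I_s | p.2 == p.1.+1 :> nat}.

Definition pairing (r s : nat) (a : simple_root s) (c : curve_class s) : int :=
  match a with
  | None => deg c - \sum_(i in initial s r.+1) mult c i
  | Some p => mult c (val p).1 - mult c (val p).2
  end.

Definition coroot (r s : nat) (a : simple_root s) : curve_class s :=
  match a with
  | None => mkclass (r%:Z - 1) (fun i => (i \in initial s r.+1)%:Z)
  | Some p => ecls (val p).1 - ecls (val p).2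
  end.

Arguments pairing : simpl never.
Arguments coroot : simpl never.

Definition simple_reflection (r s : nat) (a : simple_root s) :
    curve_class s -> curve_class s :=
  reflect_by (@pairing r s) (@coroot r s) a.

Lemma pairing_linear r s (a : simple_root s) x y k :
  pairing r a (x + y *~ k) = pairing r a x + pairing r a y * k.
Proof.
case: a => [p|]; rewrite /pairing; first by rewrite !mult_linear; ring.
under eq_bigr do rewrite mult_linear.
by rewrite deg_linear big_split /= -mulr_suml; ring.
Qed.

Lemma deg_coroot_swap r s p : deg (coroot r (Some p : simple_root s)) = 0.
Proof. by rewrite /deg /= subr0. Qed.

Lemma mult_coroot_swap r s p i :
  mult (coroot r (Some p : simple_root s)) i =
  (i == (val p).2)%:Z - (i == (val p).1)%:Z.
Proof. by rewrite /mult /= !ffunE opprB. Qed.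

Lemma pairing_coroot_same r s (hs : (r.+1 <= s)%N) (a : simple_root s) :
  pairing r a (coroot r a) = -2.
Proof.
case: a => [[[i j] /= ij]|].
  rewrite /pairing !mult_coroot_swap /= !eqxx.
  by rewrite -!val_eqE /=; lia.
rewrite /pairing deg_mkclass; under eq_bigr => i iJ do rewrite mult_mkclass iJ.
by rewrite sumr_const card_initial //; lia.
Qed.

(** Both sides are the difference of the values, at two adjacent indices, of
    the indicator function of the first [r+1] indices: 1 if the pair straddles
    that bound and 0 otherwise. *)
Lemma pairing_coroot_mixed r s p :
  pairing r (None : simple_root s) (coroot r (Some p)) =
  pairing r (Some p : simple_root s) (coroot r None).
Proof.
rewrite /pairing deg_coroot_swap; under eq_bigr do rewrite mult_coroot_swap.
have delta (j : 'I_s) :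
    \sum_(i in initial s r.+1) (i == j)%:Z = (j \in initial s r.+1)%:Z.
  rewrite (big_mkcond (mem (initial s r.+1))) (bigD1 j) //= eqxx big1.
    by rewrite addr0; case: ifP.
  by move=> i /negPf ->; case: ifP.
by rewrite sumrB !delta !mult_mkclass; ring.
Qed.

Lemma pairing_coroot_distinct r s (a a' : simple_root s) : a != a' ->
  (pairing r a (coroot r a') = 0 /\ pairing r a' (coroot r a) = 0) \/
  (pairing r a (coroot r a') = 1 /\ pairing r a' (coroot r a) = 1).
Proof.
have mixed p : pairing r (Some p : simple_root s) (coroot r None) = 0 \/
               pairing r (Some p : simple_root s) (coroot r None) = 1.
  case: p => -[i j] /= ij; rewrite /pairing !mult_mkclass !inE /=; lia.
case: a a' => [p|] [q|] // pq; last 1 first.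
- by rewrite pairing_coroot_mixed; case: (mixed q) => ->; [left|right].
- have {}pq : (val p).1 != (val q).1 :> nat.
    apply: contraNneq pq => E; apply/eqP; congr Some; apply: val_inj.
    case: p q E => -[i j] /= ij [[k l] /= kl] E.
    by congr pair; apply: val_inj => /=; lia.
  rewrite /pairing !mult_coroot_swap.
  case: p q pq => -[i j] /= ij [[k l] /= kl] E.
  by rewrite -!val_eqE /=; lia.
- by rewrite pairing_coroot_mixed; case: (mixed p) => ->; [left|right].
Qed.

Lemma simple_reflection_cremona r s (c : curve_class s) :
  simple_reflection r None c = cremona r (initial s r.+1) c.
Proof.
apply: curve_class_eq => [|i].
  by rewrite deg_linear deg_cremona deg_mkclass.
rewrite mult_linear mult_cremona mult_mkclass.
by case: ifP => _; rewrite ?mul1r // mul0r.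
Qed.

Lemma simple_reflection_tperm r s
    (p : {p : 'I_s * 'I_s | p.2 == p.1.+1 :> nat}) c :
  simple_reflection r (Some p) c = perm_class (tperm (val p).1 (val p).2) c.
Proof.
apply: curve_class_eq => [|k].
  by rewrite deg_linear deg_coroot_swap deg_perm_class mul0r addr0.
rewrite mult_linear mult_coroot_swap mult_perm_class tpermV /pairing /=.
case: p => -[i j] /= ij; have nij : (i == j) = false.
  by rewrite -val_eqE /=; lia.
case: tpermP => [->|->|/eqP/negPf-> /eqP/negPf->];
  rewrite ?eqxx ?[j == i]eq_sym ?nij; lia.
Qed.

(** * The simple reflections generate the Weyl group *)

Section WeylInvariance.

Variables (r s : nat) (P : curve_class s -> Prop).
Hypothesis P_simple :
  forall (a : simple_root s) c, P c -> P (simple_reflection r a c).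

(** Any transposition is a product of adjacent ones: [(i j+1)] is the conjugate
    of [(i j)] by [(j j+1)]. *)
Lemma tperm_class_invariant i j c : P c -> P (perm_class (tperm i j) c).
Proof.
wlog ij : i j c / (i < j)%N.
  move=> W; case: (ltngtP i j) => [||/val_inj->]; first exact: W.
  - by rewrite tpermC; exact: W.
  - by rewrite tperm1 perm_class1.
have [k Ek] : exists k, j = (i + k).+1 :> nat by exists (j - i.+1)%N; lia.
elim: k j {ij} Ek c => [|k IH] j Ek c Pc.
  have adj : (i, j).2 == (i, j).1.+1 :> nat by rewrite /=; lia.
  by have := P_simple (Some (exist _ (i, j) adj)) Pc;
    rewrite simple_reflection_tperm.
have lt_j : ((i + k).+1 < s)%N by have := ltn_ord j; lia.
pose j' := Ordinal lt_j.
have adj : (j', j).2 == (j', j).1.+1 :> nat by rewrite /= Ek; lia.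
have P_adj x : P x -> P (perm_class (tperm j' j) x).
  move/(P_simple (Some (exist _ (j', j) adj))).
  by rewrite simple_reflection_tperm.
have [ni nj] : j' != i /\ j != i by rewrite -!val_eqE /= Ek; lia.
rewrite [tperm i j]tpermC -(tpermJ_tperm ni nj) /conjg tpermV !perm_classM.
by apply/P_adj; rewrite [tperm j' i]tpermC; apply: IH => //; apply: P_adj.
Qed.

Lemma perm_class_invariant sigma c : P c -> P (perm_class sigma c).
Proof.
have [ts -> _] := prod_tpermP sigma; elim: ts c => [|t ts IH] c Pc.
  by rewrite big_nil perm_class1.
by rewrite big_cons perm_classM; apply/IH/tperm_class_invariant.
Qed.

Lemma cremona_invariant (J : {set 'I_s}) c :
  #|J| = r.+1 -> P c -> P (cremona r J c).
Proof.
move=> cardJ Pc; have [sigma EJ] := exists_perm_initial J.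
rewrite -[c]perm_class1 -(mulVg sigma) perm_classM cremona_perm_class EJ cardJ.
apply: perm_class_invariant; rewrite -simple_reflection_cremona.
exact/P_simple/perm_class_invariant.
Qed.

Lemma cremonaK (J : {set 'I_s}) : #|J| = r.+1 -> involutive (cremona r J).
Proof.
move=> cardJ c; set t := deg c - \sum_(i in J) mult c i.
have Et : deg (cremona r J c) - \sum_(i in J) mult (cremona r J c) i = - t.
  under eq_bigr => i iJ do rewrite mult_cremona iJ.
  rewrite deg_cremona big_split /= sumr_const cardJ -mulr_natr -natr1 natz /t.
  by ring.
apply: curve_class_eq => [|i].
  by rewrite deg_cremona Et deg_cremona -/t; ring.
by rewrite mult_cremona Et mult_cremona -/t; case: ifP => // _; ring.
Qed.

(** An equivalence rather than an implication, because the group is also closed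
    under inverses. *)
Lemma weyl_invariant f : weyl_group r f -> forall c, P c <-> P (f c).
Proof.
elim=> {f} [J cardJ|sigma||f g _ IHf _ IHg|f g _ IHf fK gK] c //.
- split; first exact: cremona_invariant.
  by move/(cremona_invariant cardJ); rewrite cremonaK.
- split; first exact: perm_class_invariant.
  move/(perm_class_invariant (sigma^-1)%g).
  by rewrite -perm_classM mulgV perm_class1.
- by rewrite IHg IHf.
- by rewrite (IHf (g c)) gK.
Qed.

End WeylInvariance.

(** * Cremona reduced classes *)

Lemma cremona_reduced_sorted r s (c : curve_class s) :
  (r.+1 <= s)%N -> cremona_reduced r c ->
  exists2 sigma : {perm 'I_s},
    {homo mult c \o sigma : i j / (i <= j)%N >-> j <= i} &
    \sum_(i in initial s r.+1) mult c (sigma i) <= deg c.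
Proof.
move=> hs red; have [sigma dec] := exists_sorting_perm (mult c).
exists sigma => //; have := red (sigma @: initial s r.+1).
rewrite card_imset ?card_initial //; last exact: perm_inj.
by move=> /(_ erefl); rewrite big_imset //= => ? ? _ _ /perm_inj.
Qed.

(** After sorting, [c] is dominant for the simple roots, so its whole orbit
    descends to it, and no move raises the degree since the coroots have degree
    [r - 1] or 0. *)
Lemma reduced_deg_le r s (hr : (0 < r)%N) (hs : (r.+1 <= s)%N)
    (c x : curve_class s) :
  cremona_reduced r c -> cremona_equivalent r c x -> deg c <= deg x.
Proof.
move=> red [w Ww <-]; have [sigma dec top] := cremona_reduced_sorted hs red.
set c0 := perm_class (sigma^-1)%g c.
have mult_c0 i : mult c0 i = mult c (sigma i).
  by rewrite mult_perm_class invgK.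
have deg_c0 : deg c0 = deg c by apply: deg_perm_class.
have dom (a : simple_root s) : 0 <= pairing r a c0.
  case: a => [[[i j] /= ij]|]; rewrite /pairing subr_ge0.
    by rewrite !mult_c0; apply: dec; rewrite (eqP ij).
  by under eq_bigr do rewrite mult_c0; rewrite deg_c0.
pose P (y : curve_class s) :=
  exists n, descends (@pairing r s) (@coroot r s) c0 n y.
have P_simple (a : simple_root s) y : P y -> P (simple_reflection r a y).
  apply: descends_reflect => //.
  - exact: pairing_linear.
  - exact: pairing_coroot_same.
  - exact: pairing_coroot_distinct.
have Pc : P c.
  apply/(weyl_invariant P_simple (weyl_perm r (sigma^-1)%g)).
  by exists 0%N.
have [n dn] := (weyl_invariant P_simple Ww c).1 Pc.
rewrite -deg_c0; apply: descends_le dn; first exact: deg_linear.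
case=> [p|]; first by rewrite deg_coroot_swap.
by rewrite deg_mkclass; lia.
Qed.

Lemma numerical_weylE r s (c : curve_class s) : numerical_weyl r c ->
  r.+1%:Z * deg c + (1 - r%:Z) * \sum_i mult c i = 3 - r%:Z /\
  deg c ^+ 2 + (1 - r%:Z) * \sum_i mult c i ^+ 2 = 3 - 2 * r%:Z.
Proof.
have EF : Fcls r s = mkclass r.+1%:Z (fun=> 1) by [].
rewrite /numerical_weyl EF; set F := mkclass _ _.
have formE (x y : curve_class s) : Defs.form r x y =
    deg x * deg y + (1 - r%:Z) * \sum_(i < s) mult x i * mult y i.
  by congr (_ + _ * _); apply: eq_bigr => i _; rewrite mulrNN.
rewrite !formE deg_mkclass; case=> <- <-; split.
  rewrite mulrC; congr (_ + _ * _).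
  by apply: eq_bigr => i _; rewrite mult_mkclass mulr1.
by rewrite expr2; congr (_ + _ * _); apply: eq_bigr => i _; rewrite expr2.
Qed.

(** If a multiplicity outside the [r+1 >= 2] largest were positive, those would
    all be at least 1 and exceed the degree together. *)
Lemma reduced_line_sum_mult r s (hr : (0 < r)%N) (hs : (r.+1 <= s)%N)
    (c : curve_class s) :
  cremona_reduced r c -> (forall i, 0 <= mult c i) -> deg c = 1 ->
  \sum_i mult c i <= 1.
Proof.
move=> red m0 d1; have [sigma dec top] := cremona_reduced_sorted hs red.
rewrite d1 in top.
rewrite (reindex_perm sigma) (bigID (mem (initial s r.+1))) /=.
rewrite [X in _ + X]big1 ?addr0 // => i; rewrite inE -leqNgt => ri.
apply/eqP; rewrite eq_le m0 andbT leNgt; apply/negP => mi.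
have : \sum_(j in initial s r.+1) (1 : int) <= 1.
  apply: le_trans top; apply: ler_sum => j; rewrite inE => jr.
  have /= := dec j i ltac:(lia); lia.
rewrite sumr_const card_initial //; lia.
Qed.

Theorem theorem5p7 (r s : nat) (hr : (2 <= r)%N) (hs : (r.+1 <= s)%N) :
  ~ exists c : curve_class s,
      [/\ cremona_reduced r c, numerical_weyl r c,
          0 <= deg c, (forall i : 'I_s, 0 <= mult c i)
        & weyl_line r c].
Proof.
case=> c [red /numerical_weylE [E1 E2] d0 m0 [i [j [_ _ eqv]]]].
have d1 : deg c <= 1 by have := reduced_deg_le (ltnW hr) hs red eqv.
(* Makes the products with [r - 1] polynomial in a natural number. *)
have [k Er] : exists k, r = k.+2 by exists r.-2; lia.
have sum1 : deg c = 1 -> \sum_i mult c i = 2.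
  by move=> d; move: E1; rewrite d Er; nia.
have {}d1 : deg c = 1.
  apply/eqP; rewrite eq_le d1 /= leNgt; apply/negP => d_lt1.
  have d : deg c = 0 by lia.
  have S0 : 0 <= \sum_i mult c i by apply: sumr_ge0.
  move: S0 E1 E2; rewrite d Er.
  move: (\sum_i mult c i) (\sum_i mult c i ^+ 2) => S Q S0 E1 E2.
  (* From [(k+1) S = k - 1] and [(k+1) Q = 2k + 1]. *)
  have Q1 : Q <= 1 by nia.
  have k0 : k = 0%N by nia.
  by move: E1; rewrite k0; lia.
by have := reduced_line_sum_mult (ltnW hr) hs red m0 d1; rewrite sum1.
Qed.
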